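(* Let $m\in\mathbb N$ and let $F_i$ be $U$-statistics of orders $k_i$ driven by nonnegative functions $f_i$, $i=1,\dots,m$, such that $\prod_{i=1}^mF_i\in L_2(P_\eta)$, and assume the hereditary density $p\in L_2(P_\eta)$. Then $$\mathbb E\prod_{i=1}^mF_i(\mu)=\sum_{\sigma\in\Pi_{k_1,\dots,k_m}}\int_{B^{|\sigma|}}\Big(\bigotimes_{i=1}^mf_i\Big)_\sigma(x_1,\dots,x_{|\sigma|})\;\mathbb E\,\lambda^*_{|\sigma|}(x_1,\dots,x_{|\sigma|},\mu)\;\lambda(d(x_1,\dots,x_{|\sigma|})).$$ In particular, for $m=2$ and $k_1\ge k_2$, $$\mathbb E[F_1(\mu)F_2(\mu)]=\sum_{j=0}^{k_2}\binom{k_2}{j}\frac{k_1!}{(k_1-k_2+j)!}\int_{B^{k_1+j}}h_{k_1,j}(x_1,\dots,x_{k_1+j})\,\mathbb E[\lambda^*_{k_1+j}(x_1,\dots,x_{k_1+j},\mu)]\,\lambda(d(x_1,\dots,x_{k_1+j})),$$ with $h_{k_1,j}(x_1,\dots,x_{k_1+j})=f_2(x_1,\dots,x_{k_2})f_1(x_1,\dots,x_{k_2-j},x_{k_2+1},\dots,x_{k_1+j})$.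
   Context: $B\subset\mathbb R^d$ is a bounded Borel set with $|B|>0$; $\mathbf N$ is the space of finite integer-valued measures (finite point configurations) on $B$. $\eta$ is a Poisson point process on $B$ with finite atomless intensity measure $\lambda$ and distribution $P_\eta$; $\lambda(d(x_1,\dots,x_n))$ denotes $\lambda^n$. $\mu$ is a point process with $dP_\mu=p\,dP_\eta$, $p\ge0$ measurable, $\int p\,dP_\eta=1$, hereditary ($p(x)>0\Rightarrow p(\tilde x)>0$ for $\tilde x\subset x$). Conditional intensities: $\lambda^*_n(u_1,\dots,u_n,x)=p(x\cup\{u_1,\dots,u_n\})/p(x)$ for $p(x)>0$ (distinct $u_i\notin x$), $=0$ if $p(x)=0$, $\lambda^*_0\equiv1$. A $U$-statistic of order $k$ driven by $f$: $F(x)=\sum_{(x_1,\dots,x_k)\in x^k_{\neq}}f(x_1,\dots,x_k)$, $f:B^k\to\mathbb R$ symmetric, $f\in L_1(\lambda^k)$, $x^k_{\neq}$ the $k$-tuples of pairwise distinct points of $x$. Partitions: for $k=k_1+\dots+k_m$, $\pi=\{J_1,\dots,J_m\}$ with $J_i=\{j:k_1+\dots+k_{i-1}<j\le k_1+\dots+k_i\}$; $\Pi_{k_1,\dots,k_m}$ is the set of partitions $\sigma$ of $\{1,\dots,k\}$ each of whose blocks meets each $J_i$ in at most one element; $|\sigma|$ is its number of blocks; $(\bigotimes_{i=1}^mf_i)_\sigma:B^{|\sigma|}\to\mathbb R$ is obtained from $(z_1,\dots,z_k)\mapsto\prod_i f_i(z_{k_1+\dots+k_{i-1}+1},\dots,z_{k_1+\dots+k_i})$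 by identifying the variables whose indices lie in the same block of $\sigma$. *)

(* Defs.v *)
From HB Require Import structures.
From mathcomp Require Import all_boot all_order all_algebra.
From mathcomp Require Import all_classical all_reals all_analysis.
Set Implicit Arguments. Unset Strict Implicit. Unset Printing Implicit Defensive.
Import Order.TTheory GRing.Theory Num.Theory.
Local Open Scope classical_set_scope.
Local Open Scope ring_scope.

(* Points of R^d are d-tuples of reals; d.-tuple R carries the product       *)
(* (= Borel) sigma-algebra of the library.  A finite point configuration     *)
(* (an element of N, a finite integer-valued measure) is represented by a    *)
(* finite sequence of points (the measure sum of the Dirac masses); all       *)
(* functions on N are required to be invariant under permutations.          *)
Notation pt R d := (d.-tuple R).

(* \int_{D^n} g d(mu^n), as an n-fold iterated integral (Tonelli: for the    *)
(* nonnegative measurable integrands used below this is the integral w.r.t.   *)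
(* the product measure mu^n on D^n).                                          *)
Fixpoint tint {dT : measure_display} {T : measurableType dT} {R : realType}
  (mu : {measure set T -> \bar R}) (D : set T) (n : nat)
  : (n.-tuple T -> \bar R) -> \bar R :=
  match n with
  | 0 => fun g => g [tuple]
  | n'.+1 => fun g =>
      (\int[mu]_(x in D) tint mu D (fun t : n'.-tuple T => g (cons_tuple x t)))%E
  end.

Section PoissonDefs.
Variables (R : realType) (d : nat).
Local Notation T := (pt R d).

Definition origin : T := nseq_tuple d 0.

Definition cfg_in (D : set T) (s : seq T) : Prop := forall x, x \in s -> D x.

Definition tuples_in (D : set T) (n : nat) : set (n.-tuple T) :=
  [set t | forall i, D (tnth t i)].

Definition leb_vol (B : set T) : \bar R :=
  tint (@lebesgue_measure R) setT (fun t : d.-tuple R => (\1_B t)%:E).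

(* Expectation E g(eta) for eta a Poisson process on D with finite intensity *)
(* measure mu (restricted to D):                                             *)
(*   E g(eta) = e^{-mu(D)} sum_n 1/n! int_{D^n} g(d_{x1}+...+d_{xn}) mu^n.    *)
Definition poisson_expect (mu : {measure set T -> \bar R}) (D : set T)
  (g : seq T -> \bar R) : \bar R :=
  ((expR (- fine (mu D)))%:E *
   \sum_(0 <= n <oo) ((n`!%:R)^-1)%:E * tint mu D (fun t : n.-tuple T => g t))%E.

(* Expectation E g(mu) for the process mu with dP_mu = p dP_eta *)
Definition dens_expect (mu : {measure set T -> \bar R}) (D : set T)
  (p : seq T -> R) (g : seq T -> \bar R) : \bar R :=
  poisson_expect mu D (fun x => ((p x)%:E * g x)%E).

Definition lamstar (p : seq T -> R) (u x : seq T) : R :=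
  if u == [::] then 1 else if 0 < p x then p (u ++ x) / p x else 0.

Definition ustat (k : nat) (f : seq T -> R) (x : seq T) : R :=
  \sum_(t : k.-tuple 'I_(size x) | uniq t) f [seq tnth (in_tuple x) i | i <- t].

End PoissonDefs.
Arguments tuples_in {R d} D n _.

Section Partitions.
Variables (m : nat) (k : 'I_m -> nat).

Definition offset (i : 'I_m) : nat := (\sum_(l < m | (l < i)%N) k l)%N.
Definition ktot : nat := (\sum_(i < m) k i)%N.

Definition Jblock (i : 'I_m) : {set 'I_ktot} :=
  [set j : 'I_ktot | (offset i <= j < offset i + k i)%N].

Definition admissible (P : {set {set 'I_ktot}}) : bool :=
  finset.partition P [set: 'I_ktot] &&
  [forall A in P, forall i, #|A :&: Jblock i| <= 1]%N.

(* (tensor_i f_i)_sigma (x_1,...,x_|sigma|): the blocks of sigma are listed *)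
(* in the order of enum P, block number b receiving the variable x_{b+1}.  *)
Definition tensor_sigma (R : realType) (d : nat)
  (f : 'I_m -> seq (pt R d) -> R) (P : {set {set 'I_ktot}}) (x : seq (pt R d)) : R :=
  let zs := [seq nth (origin R d) x (index (finset.pblock P j) (enum P)) | j <- enum 'I_ktot] in
  \prod_(i < m) f i (take (k i) (drop (offset i) zs)).

End Partitions.

(* Main.v *)
Require Import Defs.
From HB Require Import structures.
From mathcomp Require Import all_boot all_order all_algebra.
From mathcomp Require Import all_classical all_reals all_analysis.
From mathcomp Require Import measurable_realfun.
From mathcomp Require Import zify ring.
Set Implicit Arguments. Unset Strict Implicit. Unset Printing Implicit Defensive.
Import Order.TTheory GRing.Theory Num.Theory.
Local Open Scope ring_scope.

(** Expanding each U-statistic as a sum over tuples of pairwise distinct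
positions, a product of U-statistics is a sum over all labellings of the
variables 1, ..., k by positions that are injective on every J_i.  Sorting
these labellings by the partition of {1, ..., k} into sets of equally labelled
variables gives, pointwise and for every configuration,
[prod_i F_i = sum_sigma U_sigma], where U_sigma is the U-statistic of order
|sigma| driven by the tensor product identified along sigma.  For two factors,
symmetry of f_1 and f_2 turns this into a sum over pairs of finite sets,
sorted by the size of their difference.

Everything being nonnegative, it remains to compute E U(mu) for one
U-statistic: expanding the Poisson expectation as a series, permutation
invariance of lambda^n and of the density, and Tonelli, give
[E U(mu) = int g(u) E p(u + eta) lambda^r(du)], and heredity gives
[p(u + x) = p(x) lambda^*(u, x)]. *)

(** * Products of U-statistics *)

(** Distributivity when the index type varies with the factor, as the tuple lengths [k i] do. Each
    factor is written as a sum over the tagged union of the [T_ i], restricted to the tag [i], where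
    the usual expansion of a product of sums applies. *)
Lemma prodr_sum_fprod (R : comPzSemiRingType) (I : finType) (T_ : I -> finType)
    (F : forall i, T_ i -> R) :
  \prod_(i : I) \sum_(t : T_ i) F i t =
  \sum_(t : fprod T_) \prod_(i : I) F i (t i).
Proof.
have := @big_fprod R 0 1 *%R +%R I T_ (fun i => [ffun t => F i t]).
under [LHS]eq_bigr do under eq_bigr do rewrite ffunE.
move=> ->; rewrite -(bigA_distr_big_dep (fun i => tagged_with T_ i)
  (fun i => untag 0 [ffun t => F i t])); apply: eq_bigr => i _.
rewrite (big_tag (fun i t => F i t)); apply: eq_bigr => u _.
by congr untag; apply/funext => t; rewrite ffunE.
Qed.

(** * Labellings of the variables and partitions of their indices *)

Section Blocks.
Variables (m : nat) (k : 'I_m -> nat).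

Lemma offset_leq (i : 'I_m) : (offset k i + k i <= ktot k)%N.
Proof.
rewrite /ktot (bigID (fun l : 'I_m => (l < i)%N))/= leq_add2l.
by rewrite (bigD1 i) ?ltnn//= leq_addr.
Qed.

(* The index in {1, ..., k} of the j-th variable of f_i. *)
Definition jrank (i : 'I_m) (j : 'I_(k i)) : 'I_(ktot k) := tagnat.Rank i j.

Lemma val_jrank i j : @jrank i j = (offset k i + j)%N :> nat.
Proof. exact: tagnat.RankEsum. Qed.

Lemma jrank_inj i : injective (@jrank i).
Proof.
move=> j j' /(congr1 (@nat_of_ord _)); rewrite !val_jrank => /addnI; exact: val_inj.
Qed.

(** As lists of naturals, both sides are the interval of length [k i] that starts at
    [offset k i]. *)
Lemma take_drop_enum (i : 'I_m) :
  take (k i) (drop (offset k i) (enum 'I_(ktot k))) =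
  [seq jrank j | j <- enum 'I_(k i)].
Proof.
apply: (inj_map val_inj); rewrite map_take map_drop val_enum_ord drop_iota add0n.
rewrite take_iota -map_comp.
rewrite (eq_map (g := addn (offset k i) \o val)); last by move=> j; exact: val_jrank.
rewrite map_comp val_enum_ord -iotaDl addn0; congr iota.
by have := offset_leq i; lia.
Qed.

Lemma take_drop_map (A : Type) (c : 'I_(ktot k) -> A) (i : 'I_m) :
  take (k i) (drop (offset k i) [seq c s | s <- enum 'I_(ktot k)]) =
  [seq c (jrank j) | j <- enum 'I_(k i)].
Proof. by rewrite -map_drop -map_take take_drop_enum -map_comp. Qed.

Lemma mem_Jblock (i : 'I_m) s : reflect (exists j : 'I_(k i), s = jrank j) (s \in Jblock k i).
Proof.
rewrite inE; apply: (iffP andP) => [[os so]|[j ->]]; last first.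
  by rewrite val_jrank leq_addr ltn_add2l.
have si : (s - offset k i < k i)%N by lia.
by exists (Ordinal si); apply: ord_inj; rewrite val_jrank /= subnKC.
Qed.

Section Labelling.
Variable I : finType.
Implicit Types phi : {ffun 'I_(ktot k) -> I}.

Definition jtuple phi (i : 'I_m) : (k i).-tuple I := [tuple phi (jrank j) | j < k i].

Lemma jtuple_val phi i : jtuple phi i = [seq phi (jrank j) | j <- enum 'I_(k i)] :> seq I.
Proof. by rewrite /= -val_ord_tuple. Qed.

(** [tagnat.sig] decodes an index as a factor and a position in it, so this inverts the cutting of a
    labelling into one tuple per factor. *)
Definition label_of (t : fprod (fun i : 'I_m => (k i).-tuple I)) :
    {ffun 'I_(ktot k) -> I} :=
  [ffun s => let u := @tagnat.sig m k s in tnth (t (tag u)) (tagged u)].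

Lemma jtuple_bij : bijective (fun phi =>
  [fprod i : 'I_m => jtuple phi i] : fprod (fun i : 'I_m => (k i).-tuple I)).
Proof.
exists label_of => [phi|t].
  apply/ffunP => s; rewrite ffunE /= fprodE tnth_mktuple; congr (phi _).
  by rewrite /jrank -tagnat.rankE tagnat.sigK.
apply/fprodP => i; rewrite fprodE; apply: eq_from_tnth => j.
by rewrite tnth_mktuple ffunE /jrank tagnat.rankK.
Qed.

Lemma uniq_jtupleP phi i :
  reflect {in Jblock k i &, injective phi} (uniq (jtuple phi i)).
Proof.
rewrite jtuple_val; apply: (iffP idP) => [/injectiveP inj s t|inj].
  move=> /mem_Jblock[j ->] /mem_Jblock[j' ->] /inj -> //.
apply/injectiveP => j j' /inj jj'; apply: (@jrank_inj i); apply: jj'; apply/mem_Jblock.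
  by exists j.
by exists j'.
Qed.

Lemma mem_pblock_preim phi s t :
  (t \in finset.pblock (finset.preim_partition phi [set: 'I_(ktot k)]) s) =
  (phi s == phi t).
Proof.
rewrite finset.pblock_equivalence_partition ?inE//.
by split=> //= /eqP ->.
Qed.

(** Two variables of one [J_i] share a block of the level partition of [phi] exactly when they carry
    the same label. *)
Lemma preim_admissible phi :
  admissible (finset.preim_partition phi [set: 'I_(ktot k)]) =
  [forall i, uniq (jtuple phi i)].
Proof.
set P := finset.preim_partition _ _.
have partP : finset.partition P [set: 'I_(ktot k)] by exact: finset.preim_partitionP.
have /and3P[/eqP covP trivP _] := partP.
rewrite /admissible partP /=; apply/forall_inP/forallP => [h i|h A AP].
  apply/uniq_jtupleP => s t sJ tJ st.
  have /h /forallP /(_ i) /card_le1_eqP : finset.pblock P s \in P.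
    by rewrite finset.pblock_mem// covP inE.
  apply; rewrite finset.in_setI ?sJ ?tJ ?andbT.
    by rewrite mem_pblock_preim st.
  by rewrite mem_pblock_preim.
apply/forallP => i; apply/card_le1_eqP => s t.
rewrite !finset.in_setI => /andP[sA sJ] /andP[tA tJ].
apply: (uniq_jtupleP _ _ (h i)) => //; apply/eqP.
have : t \in finset.pblock P s by rewrite (finset.def_pblock trivP AP sA).
by rewrite mem_pblock_preim eq_sym.
Qed.

Lemma preim_partitionE phi P : finset.partition P [set: 'I_(ktot k)] ->
  (forall s t, (phi s == phi t) = (t \in finset.pblock P s)) ->
  finset.preim_partition phi [set: 'I_(ktot k)] = P.
Proof.
move=> partP phiP; rewrite -[RHS](equivalence_partition_pblock partP).
apply: eq_imset => s; apply/setP => t.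
by rewrite !inE phiP.
Qed.

(** A labelling whose level sets are the blocks of [P] is constant on each block and separates the
    blocks, so it amounts to an injective labelling [w] of the blocks. *)
Lemma sum_label_partition (V : nmodType) (P : {set {set 'I_(ktot k)}})
    (F : {ffun 'I_(ktot k) -> I} -> V)
    (b : 'I_(ktot k) -> 'I_#|P|) :
  finset.partition P [set: 'I_(ktot k)] ->
  (forall s, b s = index (finset.pblock P s) (enum P) :> nat) ->
  \sum_(phi : {ffun 'I_(ktot k) -> I} | finset.preim_partition phi [set: 'I_(ktot k)] == P) F phi =
  \sum_(w : #|P|.-tuple I | uniq w) F [ffun s => tnth w (b s)].
Proof.
move=> partP bE; have /and3P[/eqP covP trivP nP0] := partP.
have PE s : finset.pblock P s = nth finset.set0 (enum P) (b s).
  by rewrite bE nth_index// mem_enum finset.pblock_mem// covP inE.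
have bP s t : (b s == b t) = (t \in finset.pblock P s).
  rewrite -finset.eq_pblock ?covP ?inE// !PE -val_eqE /=.
  by rewrite nth_uniq ?enum_uniq// -cardE ltn_ord.
(* Blocks are nonempty, so each has a representative; reading [phi] at the representatives recovers
   [w]. *)
have [rep repK] : exists rep : 'I_#|P| -> 'I_(ktot k), forall i, b (rep i) = i.
  apply: (@fin_all_exists _ _ (fun i s => b s = i)) => i; set A := nth finset.set0 (enum P) i.
  have AP : A \in P by rewrite -mem_enum mem_nth// -cardE ltn_ord.
  have /finset.set0Pn[s sA] : A != finset.set0 by apply: contraNneq nP0 => <-.
  exists s; apply/ord_inj; rewrite bE (finset.def_pblock trivP AP sA).
  by rewrite index_uniq ?enum_uniq// -cardE ltn_ord.
rewrite (reindex (fun w : #|P|.-tuple I => [ffun s => tnth w (b s)])) /=; last first.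
  exists (fun phi : {ffun 'I_(ktot k) -> I} => [tuple phi (rep i) | i < #|P|]).
    by move=> w _; apply: eq_from_tnth => i; rewrite tnth_mktuple ffunE repK.
  move=> phi; rewrite inE => /eqP phiP; apply/ffunP => s; rewrite ffunE tnth_mktuple.
  by apply/eqP; rewrite -mem_pblock_preim phiP -bP repK.
apply: eq_bigl => w; apply/eqP/idP => [wP|/tuple_uniqP uw]; last first.
  by apply: preim_partitionE => // s t; rewrite !ffunE (inj_eq uw) bP.
apply/tuple_uniqP => i j wij; rewrite -[i]repK -[j]repK; apply/eqP.
by rewrite bP -wP mem_pblock_preim !ffunE !repK wij.
Qed.

End Labelling.

Lemma prod_ustat (R : realType) (d : nat) (f : 'I_m -> seq (pt R d) -> R) x :
  \prod_(i < m) ustat (k i) (f i) x =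
  \sum_(P : {set {set 'I_(ktot k)}} | admissible P) ustat #|P| (tensor_sigma f P) x.
Proof.
set n := size x; pose X := tnth (in_tuple x).
pose G i (t : seq 'I_n) := f i [seq X j | j <- t].
transitivity (\sum_(phi : {ffun 'I_(ktot k) -> 'I_n} | [forall i, uniq (jtuple phi i)])
    \prod_(i < m) G i (jtuple phi i)).
  (* Distinctness is absorbed into the summand as a zero value, so that distributivity meets
     unrestricted sums. *)
  pose F i (t : (k i).-tuple 'I_n) := if uniq t then G i t else 0.
  transitivity (\prod_(i < m) \sum_(t : (k i).-tuple 'I_n) F i t).
    by apply: eq_bigr => i _; rewrite /ustat big_mkcond.
  rewrite prodr_sum_fprod (reindex _ (onW_bij _ (@jtuple_bij 'I_n))) /= big_mkcond.
  rewrite [RHS]big_mkcond; apply: eq_bigr => phi _.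
  case: ifPn => [/forallP u|]; last first.
    rewrite negb_forall => /existsP[i ui]; rewrite (bigD1 i)//= fprodE /F (negPf ui).
    by rewrite mul0r.
  by apply: eq_bigr => i _; rewrite fprodE /F u.
(* A labelling that is injective on every [J_i] has an admissible level partition, and is sorted by
   it. *)
rewrite (partition_big (fun phi : {ffun 'I_(ktot k) -> 'I_n} =>
    finset.preim_partition phi [set: 'I_(ktot k)])
  (@admissible m k)) /=; last by move=> phi; rewrite preim_admissible.
apply: eq_bigr => P admP; have /andP[partP _] := admP.
rewrite (eq_bigl (fun phi : {ffun 'I_(ktot k) -> 'I_n} =>
    finset.preim_partition phi [set: 'I_(ktot k)] == P)); last first.
  move=> phi; rewrite andbC; case: eqP => //= phiP.
  by rewrite -preim_admissible phiP.
have /and3P[/eqP covP _ _] := partP.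
have bP s : (index (finset.pblock P s) (enum P) < #|P|)%N.
  by rewrite cardE index_mem mem_enum finset.pblock_mem// covP inE.
rewrite (sum_label_partition _ (b := fun s => Ordinal (bP s)) partP)//.
apply: eq_bigr => w _; rewrite /tensor_sigma; apply: eq_bigr => i _.
rewrite take_drop_map /G jtuple_val -map_comp; congr f.
apply: eq_map => j /=; rewrite ffunE.
rewrite (nth_map (tnth w (Ordinal (bP (jrank j))))) ?size_tuple ?bP//.
by rewrite /X {1}(tnth_nth (tnth w (Ordinal (bP (jrank j))))).
Qed.

End Blocks.

(** * Sums over tuples with distinct entries *)

Section UniqTuples.
Variables (T : finType) (V : nmodType).
Implicit Types (D : {set T}) (F : seq T -> V).

Lemma sum_tuple_cat m n F :
  \sum_(t : (m + n).-tuple T) F t =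
  \sum_(u : m.-tuple T) \sum_(v : n.-tuple T) F (u ++ v).
Proof.
rewrite pair_bigA (reindex (fun p : m.-tuple T * n.-tuple T => cat_tuple p.1 p.2))//=.
exists (fun t : (m + n).-tuple T =>
  ([tuple tnth t (lshift n i) | i < m], [tuple tnth t (rshift m i) | i < n])).
  move=> [u v] _ /=; congr pair; apply: eq_from_tnth => i.
    by rewrite tnth_mktuple tnth_lshift.
  by rewrite tnth_mktuple tnth_rshift.
move=> t _; apply: eq_from_tnth => i /=.
by case: (split_ordP i) => j ->; rewrite ?tnth_lshift ?tnth_rshift tnth_mktuple.
Qed.

(** Peels off a final segment; two applications separate the three segments of a tuple in
    [ustat_mul]. *)
Lemma sum_uniq_cat m n F :
  \sum_(t : (m + n).-tuple T | uniq t) F t =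
  \sum_(u : m.-tuple T | uniq u)
    \sum_(v : n.-tuple T | uniq v && all (mem (~: [set x in u])) v) F (u ++ v).
Proof.
rewrite big_mkcond (@sum_tuple_cat m n (fun t => if uniq t then F t else 0)).
rewrite [RHS]big_mkcond; apply: eq_bigr => u _.
rewrite -big_mkcond /=; case: ifPn => uu; last first.
  by rewrite big_pred0// => v; rewrite cat_uniq (negPf uu).
apply: eq_bigl => v; rewrite cat_uniq uu /= andbC; congr (_ && _).
by rewrite -all_predC; apply: eq_all => x /=; rewrite !inE.
Qed.

(** A set of [r] elements has [r!] orderings, and [F] takes the same value on all of them. *)
Lemma sum_uniq_tuple r D F :
  (forall s t, size s = r -> perm_eq s t -> F s = F t) ->
  \sum_(t : r.-tuple T | uniq t && all (mem D) t) F t =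
  (\sum_(A : {set T} | (A \subset D) && (#|A| == r)) F (enum A)) *+ r`!.
Proof.
move=> symF.
rewrite (partition_big (fun t : r.-tuple T => [set x in t])
   (fun A => (A \subset D) && (#|A| == r))) /=; last first.
  move=> t /andP[ut /allP tD]; rewrite cardsE (card_uniqP ut) size_tuple eqxx andbT.
  by apply/fintype.subsetP => x; rewrite inE => /tD.
rewrite -sumrMnl; apply: eq_bigr => A /andP[AD /eqP cA].
rewrite (eq_bigl (fun t => t \in [set t : r.-tuple T | all (mem A) t & uniq t])).
  rewrite (eq_bigr (fun=> F (enum A))); last first.
    move=> t; rewrite inE => /andP[/allP tA ut].
    apply: symF; rewrite ?size_tuple//; apply: uniq_perm; rewrite ?enum_uniq//.
    have [||_ //] := uniq_min_size ut (s2 := enum A).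
    - by move=> x /tA; rewrite mem_enum.
    - by rewrite -cardE cA size_tuple.
  by rewrite sumr_const card_uniq_tuples cA ffactnn.
move=> t; rewrite inE; apply/andP/andP => [[/andP[ut _] /eqP <-]|[/allP tA ut]].
  by split=> //; apply/allP => x /=; rewrite inE.
rewrite ut; split; first by apply/allP => x /tA /(fintype.subsetP AD).
rewrite eqEcard cA cardsE (card_uniqP ut) size_tuple leqnn andbT.
by apply/fintype.subsetP => x; rewrite inE => /tA.
Qed.

End UniqTuples.

(** * Pairs of finite sets sorted by the size of their difference *)

Section TwoSubsets.
Variables (T : finType) (V : nmodType).

(* The pair (A2, A1) is encoded by A2 :&: A1, A2 :\: A1 and A1 :\: A2. *)
Lemma sum_two_subsets (k1 k2 : nat) (Psi : {set T} -> {set T} -> V) :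
  (k2 <= k1)%N ->
  \sum_(A2 : {set T} | #|A2| == k2) \sum_(A1 : {set T} | #|A1| == k1) Psi A2 A1 =
  \sum_(0 <= j < k2.+1)
    \sum_(X : {set T} | #|X| == (k2 - j)%N)
    \sum_(Y : {set T} | (Y \subset ~: X) && (#|Y| == j))
    \sum_(Z : {set T} | (Z \subset ~: (X :|: Y)) && (#|Z| == (k1 - k2 + j)%N))
      Psi (X :|: Y) (X :|: Z).
Proof.
move=> k21; rewrite pair_big /= big_mkord.
(* The index [j] is the size of [A2 :\: A1]; it is at most [k2], so [inord] does not alter it. *)
rewrite (partition_big (fun p : {set T} * {set T} => inord #|p.1 :\: p.2| : 'I_k2.+1)
  predT)//=.
apply: eq_bigr => j _; have jk2 : (j <= k2)%N by rewrite -ltnS.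
under [RHS]eq_bigr do rewrite pair_big_dep /=.
rewrite pair_big_dep /=.
pose h (q : {set T} * ({set T} * {set T})) := (q.1 :|: q.2.1, q.1 :|: q.2.2).
pose h' (p : {set T} * {set T}) := (p.1 :&: p.2, (p.1 :\: p.2, p.2 :\: p.1)).
(* [h] undoes [h'] on every pair, but [h'] undoes [h] only on disjoint triples; this remains as a
   condition on the left-hand sum. *)
rewrite (reindex_onto h h') /=; last first.
  by move=> [A2 A1] _; rewrite /h /h' /= finset.setID finset.setIC finset.setID.
apply: eq_bigl => -[X [Y Z]] /=.
(* For a triple that is not disjoint both conditions fail: the right one demands disjointness, and
   the left one demands [h' (h q) = q], which forces it. *)
have [/andP[YX ZXY]|nYZ] := boolP ((Y \subset ~: X) && (Z \subset ~: (X :|: Y)));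
  last first.
  transitivity false; last first.
    by apply/esym/negbTE; apply: contra nYZ => /and3P[_ /andP[-> _] /andP[-> _]].
  apply/negbTE; apply: contra nYZ => /andP[_ /eqP]; rewrite /h /h' /= => -[hX hY hZ].
  apply/andP; split; apply/fintype.subsetP => x.
    by rewrite -hY !inE => /andP[/norP[->]].
  rewrite -hZ !inE => /andP[/norP[nX nY] _].
  by rewrite negb_or nX nY.
have hh : h' (h (X, (Y, Z))) = (X, (Y, Z)).
  rewrite /h /h' /=; congr (_, (_, _)); apply/setP => x;
  have /implyP := fintype.subsetP YX x; have /implyP := fintype.subsetP ZXY x;
  by rewrite !inE; case: (x \in X); case: (x \in Y); case: (x \in Z).
have disj (A C : {set T}) : C \subset ~: A -> #|A :|: C| = (#|A| + #|C|)%N.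
  by rewrite -finset.disjoints_subset disjoint_sym -(leq_card_setU A C) => /eqP.
have ZX : Z \subset ~: X by apply: (fintype.subset_trans ZXY); rewrite finset.setCS finset.subsetUl.
have YE : (X :|: Y) :\: (X :|: Z) = Y by case: hh.
rewrite hh eqxx YX ZXY YE !disj// andbT /=.
apply/andP/and3P => [[/andP[/eqP c2 /eqP c1] /eqP cj]|[/eqP cX /eqP cY /eqP cZ]].
  have yj : #|Y| = j by rewrite -cj inordK// ltnS -c2 leq_addl.
  by split; apply/eqP; lia.
rewrite cX cY cZ inord_val eqxx.
by split => //; apply/andP; split; apply/eqP; lia.
Qed.

End TwoSubsets.

(** * The product of two U-statistics *)

Section UstatProduct.
Context {R : realType} {d : nat}.
Local Notation T := (pt R d).

Lemma perm_enumU (I : finType) (X Y : {set I}) : Y \subset ~: X ->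
  perm_eq (enum (X :|: Y)) (enum X ++ enum Y).
Proof.
move=> YX; apply: uniq_perm; rewrite ?enum_uniq ?cat_uniq ?enum_uniq ?andbT//=.
  by apply/hasPn => x; rewrite !mem_enum => /(fintype.subsetP YX); rewrite inE.
by move=> x; rewrite mem_cat !mem_enum inE.
Qed.

Lemma card_enum_size (I : finType) (X : {set I}) n : #|X| == n -> size (enum X) = n.
Proof. by rewrite -cardE => /eqP. Qed.

(** Both sides are sums over pairs of finite sets. The [k1! k2!] orderings of the two sets stand
    against the [(k2 - j)! j! (k1 - k2 + j)!] orderings of their intersection and differences, and
    the quotient is the coefficient. Symmetry is asked only for points of [x], because the driving
    functions are assumed symmetric on [B]. *)
Lemma ustat_mul k1 k2 (f1 f2 : seq T -> R) (x : seq T) :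
  (forall s t, size s = k1 -> {subset s <= x} -> perm_eq s t -> f1 s = f1 t) ->
  (forall s t, size s = k2 -> {subset s <= x} -> perm_eq s t -> f2 s = f2 t) ->
  (k2 <= k1)%N ->
  ustat k1 f1 x * ustat k2 f2 x =
  \sum_(0 <= j < k2.+1)
    (('C(k2, j))%:R * (k1`!)%:R / ((k1 - k2 + j)`!)%:R) *
    ustat (k1 + j) (fun t => f2 (take k2 t) * f1 (take (k2 - j) t ++ drop k2 t)) x.
Proof.
move=> sym1 sym2 k21; set n := size x.
pose X (w : seq 'I_n) := [seq tnth (in_tuple x) i | i <- w].
pose G1 w := f1 (X w); pose G2 w := f2 (X w).
have subX w : {subset X w <= x}.
  by move=> y /mapP[i _ ->]; exact: mem_tnth.
have symG1 s t : size s = k1 -> perm_eq s t -> G1 s = G1 t.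
  by move=> sz st; apply: sym1; rewrite ?size_map//; exact: perm_map.
have symG2 s t : size s = k2 -> perm_eq s t -> G2 s = G2 t.
  by move=> sz st; apply: sym2; rewrite ?size_map//; exact: perm_map.
have ustatE r (f : seq T -> R) : (forall s t, size s = r -> perm_eq s t -> f (X s) = f (X t)) ->
    ustat r f x = (\sum_(A : {set 'I_n} | #|A| == r) f (X (enum A))) *+ r`!.
  move=> symf; rewrite /ustat -/n.
  rewrite (eq_bigl (fun t : r.-tuple 'I_n => uniq t && all (mem [set: 'I_n]) t)).
    rewrite (sum_uniq_tuple [set: 'I_n] (F := f \o X) symf); congr (_ *+ _).
    by apply: eq_bigl => A; rewrite finset.subsetT.
  by move=> t; rewrite (_ : all _ t) ?andbT//; apply/allP => i _; rewrite /= inE.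
rewrite ustatE// ustatE// mulrnAl mulrnAr -mulrnA mulrC.
rewrite mulr_suml; under eq_bigr do rewrite mulr_sumr.
rewrite (sum_two_subsets (fun A2 A1 => G2 (enum A2) * G1 (enum A1)) k21).
rewrite -sumrMnl !big_mkord; apply: eq_bigr => j _.
have jk2 : (j <= k2)%N by rewrite -ltnS.
set c := (k1 - k2 + j)%N.
(* The three segments hold the points common to both sets, those only in the set of [f2], and those
   only in the set of [f1]. *)
have -> : (k1 + j = (k2 - j + j) + c)%N by rewrite subnK// /c addnA subnKC.
have szX w : size (X w) = size w by rewrite size_map.
pose Phi s := G2 (take k2 s) * G1 (take (k2 - j) s ++ drop k2 s).
(* The segments become finite sets from the last to the first: [Phi2] sums over the last one, [Phi4]
   also over the middle one, and [Phi3 a b] is [Phi2 (a ++ b)] with the two segments kept apart. *)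
pose Phi2 u := \sum_(Z : {set 'I_n} | (Z \subset ~: [set y in u]) && (#|Z| == c))
  G2 u * G1 (take (k2 - j) u ++ enum Z).
pose Phi3 a b := \sum_(Z : {set 'I_n} |
    (Z \subset ~: ([set y in a] :|: [set y in b])) && (#|Z| == c))
  G2 (a ++ b) * G1 (a ++ enum Z).
pose Phi4 a := \sum_(Y : {set 'I_n} | (Y \subset ~: [set y in a]) && (#|Y| == j))
  Phi3 a (enum Y).
have setE (A : {set 'I_n}) : [set y in enum A] = A.
  by apply/setP => y; rewrite inE mem_enum.
have set_perm (s t : seq 'I_n) : perm_eq s t -> [set y in s] = [set y in t].
  by move=> st; apply/setP => y; rewrite !inE (perm_mem st).
have PhiE : ustat (k2 - j + j + c)
    (fun t => f2 (take k2 t) * f1 (take (k2 - j) t ++ drop k2 t)) x =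
    \sum_(t : (k2 - j + j + c).-tuple 'I_n | uniq t) Phi t.
  by apply: eq_bigr => t _; rewrite /Phi /G1 /G2 /X map_cat !map_take map_drop.
have inner (u : (k2 - j + j).-tuple 'I_n) :
  \sum_(v : c.-tuple 'I_n | uniq v && all (mem (~: [set y in u])) v) Phi (u ++ v) =
  Phi2 u *+ c`!.
  have szu : size u = k2 by rewrite size_tuple subnK.
  rewrite -(sum_uniq_tuple (~: [set y in u])
    (F := fun v => G2 u * G1 (take (k2 - j) u ++ v))); last first.
    move=> s t szs st; congr (_ * _); apply: symG1; last by rewrite perm_cat2l.
    by rewrite size_cat szs size_takel ?szu ?leq_subr// /c; lia.
  apply: eq_bigr => v _; rewrite /Phi take_size_cat// drop_size_cat//.
  by rewrite takel_cat// szu leq_subr.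
have inner2 (a : (k2 - j).-tuple 'I_n) :
  \sum_(b : j.-tuple 'I_n | uniq b && all (mem (~: [set y in a])) b) Phi2 (a ++ b) =
  Phi4 a *+ j`!.
  rewrite -(sum_uniq_tuple (~: [set y in a]) (F := Phi3 a)); last first.
    move=> s t szs st; rewrite /Phi3 (set_perm _ _ st); apply: eq_bigr => Z _.
    congr (_ * _); apply: symG2; last by rewrite perm_cat2l.
    by rewrite size_cat szs size_tuple subnK.
  apply: eq_bigr => b _; rewrite /Phi2 /Phi3 take_size_cat ?size_tuple//.
  apply: eq_bigl => Z; congr ((_ \subset ~: _) && _).
  by apply/setP => y; rewrite !inE mem_cat.
have inner3 : \sum_(a : (k2 - j).-tuple 'I_n | uniq a) Phi4 a =
  (\sum_(A : {set 'I_n} | #|A| == (k2 - j)%N) Phi4 (enum A)) *+ (k2 - j)`!.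
  transitivity (\sum_(a : (k2 - j).-tuple 'I_n | uniq a && all (mem [set: 'I_n]) a) Phi4 a).
    apply: eq_bigl => a; rewrite (_ : all _ a) ?andbT//.
    by apply/allP => i _; rewrite /= inE.
  rewrite sum_uniq_tuple; last first.
    move=> s t szs st; rewrite /Phi4 (set_perm _ _ st); apply: eq_big => // Y.
    move=> /andP[_ cY]; rewrite /Phi3 (set_perm _ _ st).
    apply: eq_bigr => Z /andP[_ cZ]; congr (_ * _).
      apply: symG2; last by rewrite perm_cat2r.
      by rewrite size_cat szs (card_enum_size cY) subnK.
    apply: symG1; last by rewrite perm_cat2r.
    by rewrite size_cat szs (card_enum_size cZ) /c; lia.
  by congr (_ *+ _); apply: eq_bigl => A; rewrite finset.subsetT.
rewrite PhiE sum_uniq_cat; under [in RHS]eq_bigr do rewrite inner.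
rewrite sumrMnl sum_uniq_cat; under [in RHS]eq_bigr do rewrite inner2.
rewrite sumrMnl inner3.
(* One side lists a union by [enum], the other segment by segment; symmetry of [f1] and [f2]
   identifies them. *)
transitivity ((\sum_(A : {set 'I_n} | #|A| == (k2 - j)%N) Phi4 (enum A)) *+ (k2`! * k1`!)).
  rewrite mulnC; congr (_ *+ _); apply: eq_bigr => A cA; rewrite /Phi4 setE.
  apply: eq_bigr => Y /andP[YA cY]; rewrite /Phi3 !setE.
  apply: eq_bigr => Z /andP[ZAY cZ]; congr (_ * _).
    apply: symG2; last exact: perm_enumU.
    by rewrite (perm_size (perm_enumU YA)) size_cat (card_enum_size cA) (card_enum_size cY) subnK.
  have ZA : Z \subset ~: A.
    by apply: (fintype.subset_trans ZAY); rewrite finset.setCS finset.subsetUl.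
  apply: symG1; last exact: perm_enumU.
  rewrite (perm_size (perm_enumU ZA)) size_cat (card_enum_size cA) (card_enum_size cZ).
  lia.
rewrite -!mulrnA -[LHS]mulr_natl -[X in _ = _ * X]mulr_natl mulrA; congr (_ * _).
(* Writing [k2!] as [C(k2, j) j! (k2 - j)!] cancels the orderings of the two parts of the set of
   [f2]. *)
rewrite -(bin_fact jk2) !natrM.
field.
by rewrite pnatr_eq0 -lt0n fact_gt0.
Qed.

End UstatProduct.

(** * Iterated integrals of functions of finite sequences *)

Local Open Scope classical_set_scope.
Local Open Scope ring_scope.

(* Integrands live on sequences rather than on tuples, so that splitting off
   points is plain concatenation, without size casts. *)
Definition meas_seq {dT : measure_display} {T : measurableType dT} {R : realType}
  (g : seq T -> \bar R) :=
  forall n, measurable_fun [set: n.-tuple T] (fun t : n.-tuple T => g t).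

Definition sint {dT : measure_display} {T : measurableType dT} {R : realType}
  (mu : {measure set T -> \bar R}) n (g : seq T -> \bar R) : \bar R :=
  tint mu setT (fun t : n.-tuple T => g t).

(** Permutations and projections of coordinates both have this form, so one measurability lemma
    serves them. *)
Definition sel {T : Type} (x0 : T) (w : seq nat) (s : seq T) :=
  [seq nth x0 s j | j <- w].

Section TupleIntegral.
Context {dT : measure_display} {T : measurableType dT} {R : realType}.
Variable mu : {measure set T -> \bar R}.
Local Open Scope ereal_scope.
Implicit Types (g h : seq T -> \bar R).

Lemma sintS n g : sint mu n.+1 g = \int[mu]_x sint mu n (fun s => g (x :: s)).
Proof. by []. Qed.

Lemma eq_sint n g h : (forall s, size s = n -> g s = h s) ->
  sint mu n g = sint mu n h.
Proof.
move=> gh; rewrite /sint; congr tint; apply/funext => t; exact/gh/size_tuple.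
Qed.

Lemma sint_ge0 n g : (forall s, 0 <= g s) -> 0 <= sint mu n g.
Proof.
elim: n g => [|n IH] g g0; first exact: g0.
by rewrite sintS; apply: integral_ge0 => x _; exact: IH.
Qed.

Lemma sint_cat m n g :
  sint mu (m + n) g = sint mu m (fun u => sint mu n (fun v => g (u ++ v))).
Proof.
elim: m g => [|m IH] g //; rewrite addSn !sintS.
by apply: eq_integral => x _; rewrite IH.
Qed.

End TupleIntegral.
Arguments eq_sint {dT T R mu n g h}.

(** * Measurability, Tonelli and invariance under permutation of the variables *)

Section SigmaFiniteTupleIntegral.
Context {dT : measure_display} {T : measurableType dT} {R : realType}.
Variable mu : {sigma_finite_measure set T -> \bar R}.
Local Open Scope ereal_scope.
Implicit Types (g h : seq T -> \bar R).

Lemma measurable_rcons n : measurable_fun [set: n.-tuple T * T]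
  (fun z : n.-tuple T * T => [tuple of rcons z.1 z.2]).
Proof.
apply/measurable_fun_tnthP => i.
have [lin|] := ltnP i n.
- rewrite (_ : _ \o _ = (fun u : n.-tuple T => tnth u (Ordinal lin)) \o fst).
    apply: measurableT_comp => //; exact: measurable_tnth.
  apply/funext => -[u y] /=.
  by rewrite !(tnth_nth y)/= nth_rcons size_tuple lin.
- move=> nlei; rewrite (_ : _ \o _ = snd) //.
  apply/funext => -[u y] /=; rewrite !(tnth_nth y)/= nth_rcons size_tuple.
  have /eqP -> : (i : nat) == n by rewrite eqn_leq nlei -ltnS ltn_ord.
  by rewrite ltnn eqxx.
Qed.

Lemma measurable_tuple_nth n (x0 : T) j :
  measurable_fun [set: n.-tuple T] (fun t : n.-tuple T => nth x0 t j).
Proof.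
have [jn|nj] := ltnP j n.
- rewrite (_ : (fun _ => _) = fun t : n.-tuple T => tnth t (Ordinal jn)).
    exact: measurable_tnth.
  by apply/funext => t; rewrite (tnth_nth x0).
- rewrite (_ : (fun _ => _) = cst x0) //.
  by apply/funext => t; rewrite nth_default ?size_tuple.
Qed.

Lemma measurable_sel n (x0 : T) (w : seq nat) :
  measurable_fun [set: n.-tuple T]
    (fun t : n.-tuple T => [tuple of map (nth x0 t) (in_tuple w)]).
Proof.
apply/measurable_fun_tnthP => i.
rewrite (_ : _ \o _ = fun t : n.-tuple T => nth x0 t (tnth (in_tuple w) i)).
  exact: measurable_tuple_nth.
by apply/funext => t /=; rewrite tnth_map.
Qed.

Lemma meas_seq_sel (x0 : T) w g : meas_seq g -> meas_seq (g \o sel x0 w).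
Proof.
move=> mg n.
rewrite (_ : (fun _ => _) = (fun t : (size w).-tuple T => g t) \o
   (fun t : n.-tuple T => [tuple of map (nth x0 t) (in_tuple w)])) //.
apply: measurableT_comp (mg _) _.
exact: measurable_sel.
Qed.

Lemma meas_seq_cons x g : meas_seq g -> meas_seq (fun s => g (x :: s)).
Proof.
move=> mg n.
rewrite (_ : (fun _ => _) = (fun t : n.+1.-tuple T => g t) \o
   (fun t : n.-tuple T => [the n.+1.-tuple T of x :: t])) //.
apply: measurableT_comp (mg n.+1) _.
exact: measurable_cons.
Qed.

Lemma meas_seq_catl u g : meas_seq g -> meas_seq (fun v => g (u ++ v)).
Proof.
elim: u g => [//|x u IH] g mg.
exact: (IH (fun s => g (x :: s)) (meas_seq_cons x mg)).
Qed.

Lemma meas_seq1 g : meas_seq g -> measurable_fun setT (fun x => g [:: x]).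
Proof.
move=> mg.
rewrite (_ : (fun _ => _) = (fun t : 1.-tuple T => g t) \o
   (fun x => [the 1.-tuple T of x :: [tuple]])) //.
apply: measurableT_comp (mg 1%N) _.
exact: measurable_cons.
Qed.

Lemma measurable_meas_seq_rcons m g : meas_seq g ->
  measurable_fun setT (fun z : m.-tuple T * T => g (rcons z.1 z.2)).
Proof.
move=> mg.
rewrite (_ : (fun _ => _) = (fun t : m.+1.-tuple T => g t) \o
   (fun z : m.-tuple T * T => [tuple of rcons z.1 z.2])) //.
apply: measurableT_comp (mg m.+1) _; exact: measurable_rcons.
Qed.

(** One variable is integrated at a time: it becomes the last entry of the parameter tuple, and the
    measurability part of Tonelli's theorem applies to the pair. *)
Lemma meas_seq_sint n g : meas_seq g -> (forall s, 0 <= g s) ->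
  meas_seq (fun u => sint mu n (fun v => g (u ++ v))).
Proof.
move=> mg g0; elim: n => [|n IH] m.
  rewrite (_ : (fun _ => _) = fun t : m.-tuple T => g t); first exact: mg.
  by apply/funext => t; rewrite /sint/= cats0.
pose G u := sint mu n (fun v => g (u ++ v)).
rewrite (_ : (fun _ => _) =
   fubini_F mu (fun z : m.-tuple T * T => G (rcons z.1 z.2))).
  apply: measurable_fun_fubini_tonelli_F.
  - exact: (@measurable_meas_seq_rcons m G).
  - by move=> z; rewrite /G; apply: sint_ge0.
apply/funext => u; rewrite sintS; apply: eq_integral => y _; rewrite /G /=.
by apply: eq_sint => s _; rewrite cat_rcons.
Qed.

Lemma measurable_sint_cons n g : meas_seq g -> (forall s, 0 <= g s) ->
  measurable_fun setT (fun x => sint mu n (fun s => g (x :: s))).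
Proof. by move=> mg g0; apply: (meas_seq1 (meas_seq_sint n mg g0)). Qed.

Lemma sintZl n (c : R) g : (0 <= c)%R -> meas_seq g -> (forall s, 0 <= g s) ->
  sint mu n (fun s => c%:E * g s) = c%:E * sint mu n g.
Proof.
move=> c0; elim: n g => [//|n IH] g mg g0; rewrite !sintS.
rewrite -ge0_integralZl//; last 2 first.
- exact: measurable_sint_cons.
- by move=> x _; exact: sint_ge0.
apply: eq_integral => x _; rewrite IH//.
exact: meas_seq_cons.
Qed.

Lemma sint_sum n (I : Type) (r : seq I) (G : I -> seq T -> \bar R) :
  (forall i, meas_seq (G i)) -> (forall i s, 0 <= G i s) ->
  sint mu n (fun s => \sum_(i <- r) G i s) = \sum_(i <- r) sint mu n (G i).
Proof.
elim: n G => [//|n IH] G mG G0; rewrite sintS.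
under eq_integral.
  move=> x _; rewrite IH//; last first.
    by move=> i; exact: meas_seq_cons.
  over.
rewrite ge0_integral_sum//.
- by move=> i; exact: measurable_sint_cons.
- by move=> i x _; exact: sint_ge0.
Qed.

Lemma sint_nneseries n (G : nat -> seq T -> \bar R) :
  (forall i, meas_seq (G i)) -> (forall i s, 0 <= G i s) ->
  sint mu n (fun s => \sum_(0 <= i <oo) G i s) = \sum_(0 <= i <oo) sint mu n (G i).
Proof.
elim: n G => [//|n IH] G mG G0; rewrite sintS.
under eq_integral.
  move=> x _; rewrite IH//; last first.
    by move=> i; exact: meas_seq_cons.
  over.
rewrite integral_nneseries//.
- by move=> i; exact: measurable_sint_cons.
- by move=> i x _; exact: sint_ge0.
Qed.

(** Tonelli for the two outermost variables, in which the inner integral is jointly measurable by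
    [meas_seq_sint]. *)
Lemma sint_swap n g : meas_seq g -> (forall s, 0 <= g s) ->
  sint mu n.+2 g =
  \int[mu]_x \int[mu]_y sint mu n (fun s => g (y :: x :: s)).
Proof.
move=> mg g0; rewrite !sintS.
pose G (z : T * T) := sint mu n (fun s => g (z.1 :: z.2 :: s)).
have mG : measurable_fun setT G.
  pose H u := sint mu n (fun v => g (u ++ v)).
  rewrite (_ : G = (fun z : 1.-tuple T * T => H (rcons z.1 z.2)) \o
     (fun z : T * T => ([the 1.-tuple T of z.1 :: [tuple]], z.2))) //.
  apply: measurableT_comp.
    by apply: measurable_meas_seq_rcons; exact: meas_seq_sint.
  apply: measurable_fun_pair => //.
  exact: measurable_cons.
have G0 z : 0 <= G z by rewrite /G; apply: sint_ge0.
have := @fubini_tonelli _ _ _ _ _ mu mu G mG G0.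
by rewrite /fubini_F /fubini_G => /esym ->.
Qed.

Definition mv_front (x0 : T) i (s : seq T) := nth x0 s i :: (take i s ++ drop i.+1 s).

(* Induction on i, exchanging one pair of neighbouring variables by Tonelli. *)
Lemma sint_mv_front (x0 : T) i n g : meas_seq g -> (forall s, 0 <= g s) ->
  (i < n)%N -> sint mu n (g \o mv_front x0 i) = sint mu n g.
Proof.
elim: i n g => [|i IH] [//|n] g mg g0 lin.
  by rewrite !sintS; apply: eq_integral => x _; apply: eq_sint => s _ /=;
     rewrite /mv_front/= drop0.
case: n lin => [//|n] lin; rewrite [RHS]sint_swap// sintS.
apply: eq_integral => x _.
(* The word 1, 0, 2, 3, ... exchanges the first two entries: bringing entry [i] of the tail to its
   front and then past [x] moves entry [i + 1] of the whole sequence. *)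
pose h (s : seq T) := g (sel x0 (1%N :: 0%N :: iota 2 n) (x :: s)).
rewrite (eq_sint (h := h \o mv_front x0 i)); last first.
  move=> s szs /=; rewrite /h/= /mv_front/=; congr (g (_ :: _ :: _)).
  set r := take i s ++ _.
  have szr : size r = n.
    by rewrite /r size_cat size_drop size_takel szs; [rewrite subSS subnKC|exact: ltnW].
  by rewrite /sel (iotaDl 2 0) -map_comp -szr map_nth_iota0// take_size.
rewrite IH//; last 2 first.
- exact: (@meas_seq_cons x (g \o sel x0 _) (meas_seq_sel _ _ mg)).
- by move=> s; exact: g0.
rewrite sintS; apply: eq_integral => y _; apply: eq_sint => s szs /=.
rewrite /h /=; congr (g (_ :: _ :: _)).
by rewrite /sel -szs (iotaDl 2 0) -map_comp map_nth_iota0 // take_size.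
Qed.

(** Induction on the length: [mv_front] brings the first position [i] of [w] to the front, and the
    rest of [w] permutes the other positions. *)
Lemma sint_perm (x0 : T) n (w : seq nat) g : meas_seq g -> (forall s, 0 <= g s) ->
  perm_eq w (iota 0 n) -> sint mu n (g \o sel x0 w) = sint mu n g.
Proof.
elim: n w g => [|n IH] w g mg g0 pw.
  by rewrite (perm_nilP pw).
case: w pw => [/perm_size//|i w] pw.
have lin : (i < n.+1)%N by have := perm_mem pw i; rewrite mem_iota inE eqxx.
have uw : uniq (i :: w) by rewrite (perm_uniq pw) iota_uniq.
(* Deleting position [i] lowers the later positions by one, which is [unbump i]. *)
pose w' := map (unbump i) w.
have szw : size w = n by have /perm_size := pw; rewrite /= size_iota => -[].
have neqi j : j \in w -> j != i.
  by move=> jw; apply: contraTneq jw => ->; case/andP: uw.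
have pw' : perm_eq w' (iota 0 n).
  have uw' : uniq w'.
    rewrite map_inj_in_uniq; first by case/andP: uw.
    by move=> j k jw kw /(congr1 (bump i)); rewrite !unbumpK//; apply: neqi.
  have sub : {subset w' <= iota 0 n}.
    move=> _ /mapP[j jw ->]; rewrite mem_iota /=.
    have : j \in i :: w by rewrite inE jw orbT.
    have := neqi _ jw; rewrite (perm_mem pw) mem_iota /= /unbump => ji jn.
    case: (ltnP i j) => ij; first by rewrite subn1; case: j ij jn {jw ji}.
    rewrite subn0; rewrite add0n in jn *.
    by apply: leq_trans (_ : i <= n)%N => //; rewrite ltn_neqAle ji ij.
  apply: uniq_perm; rewrite ?iota_uniq//.
  by case: (uniq_min_size uw' sub); rewrite // size_iota size_map szw.
rewrite (eq_sint (h := (g \o sel x0 (0%N :: map S w')) \o mv_front x0 i)).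
  rewrite sint_mv_front//; last 2 first.
  - exact: meas_seq_sel.
  - by move=> s; exact: g0.
  rewrite !sintS; apply: eq_integral => y _.
  rewrite -(IH w' (fun s => g (y :: s)))//; last exact: meas_seq_cons.
  by apply: eq_sint => s _ /=; rewrite /sel -map_comp.
move=> s szs /=; congr (g (_ :: _)); rewrite /sel /w' -!map_comp.
apply/eq_in_map => j jw /=.
have lis : (i <= size s)%N by rewrite szs ltnW.
rewrite -{1}(unbumpK (neqi _ jw)) nth_cat (size_takel lis) /bump.
case: (leqP i (unbump i j)) => [ik|ki]; first by rewrite nth_drop addSn subnKC.
by rewrite nth_take.
Qed.

End SigmaFiniteTupleIntegral.

(** * The Mecke formula *)

Section FiniteMeasure.
Context {dT : measure_display} {T : measurableType dT} {R : realType}.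
Variables (mu : {measure set T -> \bar R}) (fin : fin_num_fun mu).

(* The hypothesis fin is kept in the body so that instances can be keyed on it. *)
Definition fin_measure : set T -> \bar R := let _ := fin in mu.
HB.instance Definition _ := Measure.copy fin_measure mu.
HB.instance Definition _ := Measure_isFinite.Build _ _ _ fin_measure fin.

Definition sigma_finite_of : {sigma_finite_measure set T -> \bar R} := fin_measure.

(** Passes from the bare measure of the theorem to the sigma-finite structure that Tonelli asks for;
    the set function is the same. *)
Lemma sint_sigma_finite n g : sint mu n g = sint sigma_finite_of n g.
Proof.
elim: n g => [//|n IH] g; rewrite !sintS.
under eq_integral do rewrite IH.
exact: eq_measure_integral.
Qed.

End FiniteMeasure.

Section Ustat.
Context {R : realType} {d : nat}.
Local Notation T := (pt R d).

(** With the length fixed, the index set of the sum no longer depends on [s], so sum and integral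
    can be interchanged. *)
Lemma ustat_sel r (f : seq T -> R) (s : seq T) n (szs : size s = n) :
  ustat r f s =
  \sum_(t : r.-tuple 'I_n | uniq t) f (sel (origin R d) (map val t) s).
Proof.
subst n; apply: eq_bigr => t _; congr f; rewrite /sel -map_comp.
by apply: eq_map => i /=; rewrite (tnth_nth (origin R d)).
Qed.

Variable mu : {sigma_finite_measure set T -> \bar R}.

Lemma meas_seqM (f g : seq T -> R) :
  meas_seq (EFin \o f) -> meas_seq (EFin \o g) ->
  meas_seq (fun s => (f s * g s)%:E).
Proof.
move=> mf mg n; apply: (@emeasurable_funM _ _ _ _ (fun t : n.-tuple T => (f t)%:E)
  (fun t : n.-tuple T => (g t)%:E)); [exact: mf|exact: mg].
Qed.

Variable q : seq T -> R.
Hypothesis mq : meas_seq (EFin \o q).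
Hypothesis q_ge0 : forall s, 0 <= q s.
Hypothesis q_sym : forall s t, perm_eq s t -> q s = q t.

(** Appending the missing positions completes [w] to a permutation of all [n] positions. Neither the
    integral nor [q] changes under it, and the first [size w] entries become those selected by
    [w]. *)
Lemma sint_uniq_sel n (w : seq nat) (g : seq T -> R) :
  meas_seq (EFin \o g) -> (forall s, 0 <= g s) ->
  uniq w -> {subset w <= iota 0 n} ->
  sint mu n (fun s => (q s * g (sel (origin R d) w s))%:E) =
  sint mu n (fun s => (q s * g (sel (origin R d) (iota 0 (size w)) s))%:E).
Proof.
move=> mg g0 uw wn; set x0 := origin R d.
pose w2 := w ++ [seq i <- iota 0 n | i \notin w].
have pw2 : perm_eq w2 (iota 0 n).
  apply: uniq_perm; rewrite ?iota_uniq//.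
    rewrite cat_uniq uw filter_uniq ?iota_uniq//= andbT.
    by apply/hasPn => i; rewrite mem_filter => /andP[].
  move=> i; rewrite mem_cat mem_filter.
  by case: (boolP (i \in w)) => //= /wn ->.
have szw : (size w <= n)%N.
  by rewrite -(size_iota 0 n) -(perm_size pw2) size_cat leq_addr.
rewrite -[RHS](sint_perm mu x0 _ _ pw2); last 2 first.
- apply: meas_seqM => //.
  exact: (meas_seq_sel x0 (iota 0 (size w)) mg).
- by move=> s; rewrite lee_fin mulr_ge0.
apply: eq_sint => s szs /=; congr (_ * g _)%:E.
  apply: q_sym; rewrite perm_sym -[X in perm_eq _ X](mkseq_nth x0) szs.
  exact: perm_map.
rewrite [in RHS]/sel map_nth_iota0 ?size_map ?(perm_size pw2) ?size_iota//.
by rewrite /w2 /sel map_cat take_size_cat ?size_map.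
Qed.

Lemma sint_ustat n r (g : seq T -> R) :
  meas_seq (EFin \o g) -> (forall s, 0 <= g s) ->
  sint mu n (fun s => (q s * ustat r g s)%:E) =
  ((n ^_ r)%:R%:E *
   sint mu n (fun s => (q s * g (sel (origin R d) (iota 0 r) s))%:E))%E.
Proof.
move=> mg g0; set x0 := origin R d.
rewrite (eq_sint (h := fun s => (\sum_(t <- [seq t : r.-tuple 'I_n <- index_enum _ | uniq t])
  (q s * g (sel x0 (map val t) s))%:E)%E)); last first.
  move=> s szs; rewrite (ustat_sel _ _ szs) mulr_sumr big_filter.
  by rewrite sumEFin.
rewrite sint_sum; last 2 first.
- move=> t; apply: meas_seqM => //.
  exact: (meas_seq_sel x0 (map val t) mg).
- by move=> t s; rewrite lee_fin mulr_ge0.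
rewrite big_filter.
rewrite (eq_bigr (fun _ => sint mu n (fun s => (q s * g (sel x0 (iota 0 r) s))%:E))).
  rewrite (eq_bigl (fun t => t \in [set t : r.-tuple 'I_n | all predT t & uniq t])); last first.
    by move=> t; rewrite inE (_ : all _ _ = true)//; exact/allP.
  rewrite sumr_const card_uniq_tuples cardT size_enum_ord mule_natl.
  by elim: (n ^_ r) => // k IH; rewrite mulrS IH; case: k {IH} => [|k]; rewrite ?addr0.
move=> t ut; rewrite sint_uniq_sel//.
- by rewrite size_map size_tuple.
- by rewrite map_inj_uniq//; exact: val_inj.
- by move=> _ /mapP[i _ ->]; rewrite mem_iota /= add0n ltn_ord.
Qed.

(* The Mecke formula for the density q: by symmetry of q each of the n ^_ r
   terms of the U-statistic may be evaluated at the first r of the n points, and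
   n ^_ r / n! = 1 / (n - r)!. *)
Lemma mecke_series r (g : seq T -> R) :
  meas_seq (EFin \o g) -> (forall s, 0 <= g s) ->
  (\sum_(0 <= n <oo) (n`!%:R^-1)%:E * sint mu n (fun s => (q s * ustat r g s)%:E) =
   sint mu r (fun u => (g u)%:E *
     \sum_(0 <= n <oo) (n`!%:R^-1)%:E * sint mu n (fun v => (q (u ++ v))%:E)))%E.
Proof.
move=> mg g0; set x0 := origin R d.
have mh : meas_seq (fun s => (q s * g (sel x0 (iota 0 r) s))%:E).
  apply: meas_seqM => //.
  exact: (meas_seq_sel x0 (iota 0 r) mg).
have h0 s : (0 <= (q s * g (sel x0 (iota 0 r) s))%:E)%E by rewrite lee_fin mulr_ge0.
have fact0 (n : nat) : 0 <= (n`!%:R^-1 : R) by rewrite invr_ge0 ler0n.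
under eq_eseriesr do rewrite sint_ustat//.
have tm0 n : (0 <= (n`!%:R^-1)%:E * ((n ^_ r)%:R%:E *
    sint mu n (fun s => (q s * g (sel x0 (iota 0 r) s))%:E)))%E.
  by rewrite !mule_ge0 ?lee_fin// sint_ge0.
(* For [n < r] there is no [r]-tuple of distinct positions, so these terms vanish and the series
   restarts at [n = r + k]. *)
rewrite (nneseries_split 0 r)// big_nat big1 ?add0e; last first.
  by move=> n; rewrite add0n => /andP[_ nr]; rewrite ffact_small// mul0e mule0.
rewrite add0n -nneseries_addn//.
(* [H k u] collects the configurations made of [u] and [k] further points. *)
pose H k u := ((k`!%:R^-1)%:E * sint mu k (fun v =>
   (q (u ++ v) * g (sel x0 (iota 0 r) (u ++ v)))%:E))%E.
have mH k : meas_seq (H k).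
  move=> n; apply: measurable_funeM.
  exact: (@meas_seq_sint _ _ _ mu k (fun s => (q s * g (sel x0 (iota 0 r) s))%:E)).
have H0 k u : (0 <= H k u)%E.
  rewrite mule_ge0 ?lee_fin//.
  by apply: sint_ge0 => s; exact: (h0 (u ++ s)).
transitivity (\sum_(0 <= k <oo) sint mu r (H k))%E; last first.
  rewrite -sint_nneseries//; apply: eq_sint => u szu.
  rewrite -nneseriesZl; last first.
    move=> k _; rewrite mule_ge0 ?lee_fin//.
    by apply: sint_ge0 => s; rewrite lee_fin.
  apply: eq_eseriesr => k _; rewrite muleCA; congr (_ * _)%E.
  rewrite -sintZl//; last 2 first.
  - exact: (meas_seq_catl u mq).
  - by move=> s; rewrite lee_fin.
  apply: eq_sint => v szv; rewrite -EFinM mulrC; congr (g _ * _)%:E.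
  by rewrite /sel map_nth_iota0 ?size_cat ?szu ?leq_addr// take_size_cat.
apply: eq_eseriesr => k _; rewrite addnC sint_cat.
rewrite /H sintZl//; last 2 first.
- exact: (@meas_seq_sint _ _ _ mu k (fun s => (q s * g (sel x0 (iota 0 r) s))%:E)).
- by move=> u; apply: sint_ge0 => s; exact: (h0 (u ++ s)).
rewrite muleA -EFinM; congr (_%:E * _)%E.
have := @ffact_fact (r + k) r (leq_addr _ _); rewrite addKn => <-.
rewrite natrM invfM mulrAC mulVf ?mul1r// pnatr_eq0 -lt0n ffact_gt0.
exact: leq_addr.
Qed.

End Ustat.

(** * Extension by zero from [B] to the whole space *)

Section Restriction.
Context {R : realType} {d : nat}.
Local Notation T := (pt R d).
Variable B : set T.
Hypothesis mB : measurable B.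

Lemma cfg_in_cat (s t : seq T) : cfg_in B (s ++ t) <-> cfg_in B s /\ cfg_in B t.
Proof.
split=> [h|[hs ht] x]; first by split=> x xs; apply: h; rewrite mem_cat xs ?orbT.
by rewrite mem_cat => /orP[/hs|/ht].
Qed.

Lemma cfg_in_cons x (s : seq T) : cfg_in B (x :: s) <-> B x /\ cfg_in B s.
Proof.
rewrite -cat1s cfg_in_cat; split=> -[hx hs]; split=> //.
  by apply: hx; rewrite inE.
by move=> y; rewrite inE => /eqP ->.
Qed.

Lemma cfg_in_tuple n (t : n.-tuple T) : cfg_in B t <-> tuples_in B n t.
Proof.
split=> [h i|h x /tnthP[i ->]]; last exact: h.
by apply: h; exact: mem_tnth.
Qed.

(** Hypotheses given on configurations in [B] become global ones for the extension, as the lemmas on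
    [sint] require. *)
Definition restr (f : seq T -> R) (s : seq T) : R :=
  if `[< cfg_in B s >] then f s else 0.

Lemma restrT f s : cfg_in B s -> restr f s = f s.
Proof. by move=> Bs; rewrite /restr asboolT. Qed.

Lemma restrF f s : ~ cfg_in B s -> restr f s = 0.
Proof. by move=> Bs; rewrite /restr asboolF. Qed.

Lemma restr_ge0 f : (forall s, cfg_in B s -> 0 <= f s) -> forall s, 0 <= restr f s.
Proof. by move=> f0 s; rewrite /restr; case: asboolP => // /f0. Qed.

Lemma measurable_tuples_in n : measurable (@tuples_in R d B n).
Proof.
rewrite (_ : tuples_in B n = \bigcap_(i in setT) ((fun t : n.-tuple T => tnth t i) @^-1` B)).
  apply: fin_bigcap_measurable => // i _.
  by rewrite -[X in measurable X]setTI; exact: measurable_tnth.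
by apply/seteqP; split=> t h i; [move=> _; exact: h|exact: (h i I)].
Qed.

Lemma meas_seq_restr (f : seq T -> R) :
  (forall n, measurable_fun (tuples_in B n) (fun t : n.-tuple T => f t)) ->
  meas_seq (EFin \o restr f).
Proof.
move=> mf n; apply/(@measurable_EFinP _ _ _ _ (fun t : n.-tuple T => restr f t)).
have /measurable_restrictT := mf n; move=> /(_ (@measurable_tuples_in n)).
congr measurable_fun; apply/funext => t; rewrite /restr /patch.
congr (if _ then _ else _).
by apply/asboolP/idP => [/cfg_in_tuple /mem_set|/set_mem /cfg_in_tuple].
Qed.

Lemma sint0 (mu : {measure set T -> \bar R}) n : sint mu n (fun=> 0%E) = 0%E.
Proof.
elim: n => [//|n IH]; rewrite sintS.
by under eq_integral do rewrite IH; rewrite integral0.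
Qed.

(** The indicators of [B] in the successive variables combine into one indicator of the whole
    configuration. *)
Lemma tint_restr (mu : {measure set T -> \bar R}) n (g : seq T -> \bar R) :
  tint mu B (fun t : n.-tuple T => g t) =
  sint mu n (fun s => if `[< cfg_in B s >] then g s else 0%E).
Proof.
elim: n g => [|n IH] g.
  by rewrite /sint /= asboolT.
rewrite sintS /= integral_mkcond; apply: eq_integral => x _.
rewrite /patch; case: ifPn => xB.
  rewrite (IH (fun s => g (x :: s))); apply: eq_sint => s _.
  congr (if _ then _ else _); apply: asbool_equiv_eq.
  by rewrite cfg_in_cons; split=> [|[]//]; split=> //; exact: set_mem.
transitivity (sint mu n (fun=> 0%E)); first by rewrite sint0.
apply: eq_sint => s _.
by rewrite asboolF// => /cfg_in_cons[/mem_set]; rewrite (negPf xB).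
Qed.

End Restriction.

(** * Expectations under the density [p] *)

Section Process.
Context {R : realType} {d : nat}.
Local Notation T := (pt R d).
Variables (B : set T) (lam : {measure set T -> \bar R}) (p : seq T -> R).
Hypotheses (mB : measurable B) (lam_out : lam (~` B) = 0%E) (lam_fin : (lam B < +oo)%E).
Hypothesis p_sym : forall x y, cfg_in B x -> perm_eq x y -> p x = p y.
Hypothesis p_meas :
  forall n, measurable_fun (tuples_in B n) (fun t : n.-tuple T => p t).
Hypothesis p_ge0 : forall x, cfg_in B x -> 0 <= p x.
Hypothesis p_her : forall x y, cfg_in B (x ++ y) -> 0 < p (x ++ y) -> 0 < p x.

Lemma lam_fin_num : fin_num_fun lam.
Proof.
move=> A mA; rewrite ge0_fin_numE//.
apply: le_lt_trans (_ : (lam setT < +oo)%E); first by apply: le_measure; rewrite ?inE.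
rewrite -(setUv B) measureU//; [|exact: measurableC|exact: setICr].
have lam_out_fin : (lam (~` B) < +oo)%E by rewrite lam_out ltry.
exact: lte_add_pinfty lam_fin lam_out_fin.
Qed.

Let q := restr B p.
Let c := (expR (- fine (lam B)))%:E.

Lemma dens_expectE (F : seq T -> \bar R) :
  dens_expect lam B p F =
  (c * \sum_(0 <= n <oo) (n`!%:R^-1)%:E * sint lam n (fun s => (q s)%:E * F s))%E.
Proof.
congr (_ * _)%E; apply: eq_eseriesr => n _; congr (_ * _)%E.
rewrite (tint_restr B lam n (fun s => (p s)%:E * F s)%E).
apply: eq_sint => s _; rewrite /q /restr; case: ifP => // _.
by rewrite mul0e.
Qed.

Lemma mul_lamstar u v : cfg_in B u -> q v * lamstar p u v = q (u ++ v).
Proof.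
move=> Bu; rewrite /q; have [Bv|nBv] := pselect (cfg_in B v); last first.
  by rewrite !restrF ?mul0r// => /cfg_in_cat[].
have Buv : cfg_in B (u ++ v) by apply/cfg_in_cat.
rewrite !restrT// /lamstar; case: eqP => [->|_]; first by rewrite mulr1.
case: ifPn => [pv0|]; first by rewrite mulrC divfK// gt_eqF.
(* If [p v] vanishes, so does [p (u ++ v)]: otherwise heredity, applied to the reordering [v ++ u],
   would make [p v] positive. *)
move=> /negP npv; rewrite mulr0; apply/eqP; apply: contra_notT npv => puv0.
have Bvu : cfg_in B (v ++ u) by apply/cfg_in_cat.
have pvu : perm_eq (v ++ u) (u ++ v) by rewrite perm_catC.
apply: (p_her Bvu); rewrite (p_sym Bvu pvu).
by rewrite lt_neqAle puv0 p_ge0.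
Qed.

Lemma dens_expect_lamstar u : cfg_in B u ->
  dens_expect lam B p (fun y => (lamstar p u y)%:E) =
  (c * \sum_(0 <= n <oo) (n`!%:R^-1)%:E * sint lam n (fun v => (q (u ++ v))%:E))%E.
Proof.
move=> Bu; rewrite dens_expectE; congr (_ * _)%E.
apply: eq_eseriesr => n _; congr (_ * _)%E.
by apply: eq_sint => v _; rewrite -EFinM mul_lamstar.
Qed.

(** The common form of both claims: a finite nonnegative combination of U-statistics, treated by
    linearity and the Mecke formula for each term. *)
Lemma dens_expect_ustats (J : Type) (r : seq J) (P : pred J) (a : J -> R)
    (k : J -> nat) (g : J -> seq T -> R) (F : seq T -> R) :
  (forall j, 0 <= a j) ->
  (forall j, P j -> measurable_fun (tuples_in B (k j)) (fun t : (k j).-tuple T => g j t)) ->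
  (forall j s, P j -> size s = k j -> cfg_in B s -> 0 <= g j s) ->
  (forall s, cfg_in B s -> F s = \sum_(j <- r | P j) a j * ustat (k j) (g j) s) ->
  dens_expect lam B p (fun s => (F s)%:E) =
  (\sum_(j <- r | P j) (a j)%:E * tint lam B (fun t : (k j).-tuple T =>
     (g j t)%:E * dens_expect lam B p (fun y => (lamstar p t y)%:E)))%E.
Proof.
move=> a0 mg g0 FE.
(* Zero also replaces [g j] at wrong lengths and off [P], where nothing is known of its sign or
   measurability. *)
pose g' j := restr B (fun s => if P j && (size s == k j) then g j s else 0).
have g'0 j s : 0 <= g' j s.
  apply: restr_ge0 => {}s Bs; by case: ifP => // /andP[Pj /eqP szs]; exact: g0.
have mg' j : meas_seq (EFin \o g' j).
  apply: meas_seq_restr => // n.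
  have [Pj|_] := boolP (P j); last exact: measurable_cst.
  have [->|nk] := eqVneq n (k j).
    rewrite (_ : (fun _ => _) = (fun t : (k j).-tuple T => g j t)); first exact: mg.
    by apply/funext => t; rewrite size_tuple eqxx.
  rewrite (_ : (fun _ => _) = cst 0); first exact: measurable_cst.
  by apply/funext => t; rewrite size_tuple (negPf nk).
have mq : meas_seq (EFin \o q) by exact: meas_seq_restr.
have q0 s : 0 <= q s by exact: restr_ge0.
have q_sym s t : perm_eq s t -> q s = q t.
  move=> st; rewrite /q; have [Bs|nBs] := pselect (cfg_in B s).
    by rewrite !restrT//; [exact: p_sym|move=> x; rewrite -(perm_mem st); exact: Bs].
  by rewrite !restrF// => Bt; apply: nBs => x; rewrite (perm_mem st); exact: Bt.
have fact0 (n : nat) : 0 <= (n`!%:R^-1 : R) by rewrite invr_ge0 ler0n.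
have us0 j s : 0 <= ustat (k j) (g' j) s by rewrite /ustat sumr_ge0.
pose mu := sigma_finite_of lam_fin_num.
have mus j : meas_seq (fun s => (q s * ustat (k j) (g' j) s)%:E).
  apply: meas_seqM => // n.
  rewrite (_ : (fun _ => _) = fun t : n.-tuple T =>
     (\sum_(w <- [seq w : (k j).-tuple 'I_n <- index_enum _ | uniq w])
        (g' j (sel (origin R d) (map val w) t))%:E)%E).
    apply: emeasurable_sum => w.
    exact: (meas_seq_sel (origin R d) (map val w) (mg' j)).
  apply/funext => t /=.
  by rewrite (ustat_sel _ _ (size_tuple t)) big_filter sumEFin.
rewrite dens_expectE.
transitivity (c * \sum_(0 <= n <oo) \sum_(j <- r | P j)
   (a j)%:E * ((n`!%:R^-1)%:E * sint mu n (fun s => (q s * ustat (k j) (g' j) s)%:E)))%E.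
  congr (_ * _)%E; apply: eq_eseriesr => n _.
  rewrite (sint_sigma_finite lam_fin_num).
  rewrite (eq_sint (h := fun s => (\sum_(j <- [seq j <- r | P j])
     (a j)%:E * (q s * ustat (k j) (g' j) s)%:E)%E)); last first.
    move=> s _; rewrite big_filter -EFinM.
    have [Bs|nBs] := pselect (cfg_in B s); last first.
      rewrite /q restrF// mul0r big1// => j _.
      by rewrite mul0r mule0.
    rewrite FE// mulr_sumr -sumEFin; apply: eq_bigr => j Pj.
    rewrite -EFinM mulrCA; congr (_ * (_ * _))%:E.
    (* Points drawn from a configuration in [B] lie in [B], so [g'] and [g] agree on them. *)
    apply: eq_bigr => w _; rewrite /g' restrT; last first.
      move=> x /mapP[i _ ->]; apply: Bs; exact: mem_tnth.
    by rewrite Pj size_map size_tuple eqxx.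
  rewrite sint_sum; last 2 first.
  - by move=> j m; apply: measurable_funeM; exact: (mus j m).
  - by move=> j s; rewrite mule_ge0 ?lee_fin ?mulr_ge0.
  rewrite big_filter ge0_sume_distrr; last first.
    move=> j _; apply: sint_ge0 => s.
    by rewrite mule_ge0 ?lee_fin ?mulr_ge0.
  apply: eq_bigr => j _; rewrite sintZl//; last first.
    by move=> s; rewrite lee_fin mulr_ge0.
  by rewrite muleCA.
rewrite nneseries_sum; last first.
  move=> j n _; rewrite !mule_ge0 ?lee_fin// sint_ge0// => s.
  by rewrite lee_fin mulr_ge0.
have S0 j n : (0 <= (n`!%:R^-1)%:E * sint mu n (fun s => (q s * ustat (k j) (g' j) s)%:E))%E.
  rewrite !mule_ge0 ?lee_fin// sint_ge0// => s.
  by rewrite lee_fin mulr_ge0.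
rewrite ge0_sume_distrr; last first.
  by move=> j _; apply: nneseries_ge0 => n _ _; rewrite mule_ge0 ?lee_fin.
apply: eq_bigr => j Pj; rewrite nneseriesZl// muleCA; congr (_ * _)%E.
rewrite (mecke_series mu mq q0 q_sym (k j) (mg' j) (g'0 j)).
have Q0 u n : (0 <= (n`!%:R^-1)%:E * sint mu n (fun v => (q (u ++ v))%:E))%E.
  by rewrite mule_ge0 ?lee_fin// sint_ge0// => s; rewrite lee_fin.
(* The constant [c] goes under the integral over [u], where it completes the inner series to the
   expectation of [lamstar]. *)
rewrite -[c]/((expR (- fine (lam B)))%:E) -sintZl ?expR_ge0//; last 2 first.
- move=> n; apply: emeasurable_funM; first exact: (mg' j n).
  apply: ge0_emeasurable_sum => [m x _ _|m _]; first exact: Q0.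
  apply: measurable_funeM.
  exact: (@meas_seq_sint _ _ _ mu m (EFin \o q)).
- by move=> u; rewrite mule_ge0 ?lee_fin//; apply: nneseries_ge0 => n _ _; exact: Q0.
rewrite (tint_restr B lam (k j) (fun t =>
  (g j t)%:E * dens_expect lam B p (fun y => (lamstar p t y)%:E))%E).
rewrite (sint_sigma_finite lam_fin_num); apply: eq_sint => u szu.
have [Bu|nBu] := pselect (cfg_in B u); last first.
  by rewrite /g' restrF// mul0e mule0 asboolF.
rewrite asboolT// /g' restrT// Pj szu eqxx/= dens_expect_lamstar// muleCA.
congr (_ * (_ * _))%E; apply: eq_eseriesr => n _.
by rewrite (sint_sigma_finite lam_fin_num).
Qed.

End Process.

(** * Measurability of the integrands *)

Section Selection.
Context {R : realType} {d : nat}.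
Local Notation T := (pt R d).
Variable B : set T.
Hypothesis mB : measurable B.
Let x0 := origin R d.

(** The positions must be valid: past the end [nth] returns the origin, which may lie outside
    [B]. *)
Lemma cfg_in_sel (w : seq nat) (s : seq T) :
  all (fun i => i < size s)%N w -> cfg_in B s -> cfg_in B (sel x0 w s).
Proof. by move=> /allP ws Bs _ /mapP[i /ws iw ->]; apply: Bs; exact: mem_nth. Qed.

Lemma measurable_fun_sel n k (w : seq nat) (f : seq T -> R) :
  size w = k -> all (fun i => i < n)%N w ->
  measurable_fun (tuples_in B k) (fun t : k.-tuple T => f t) ->
  measurable_fun (tuples_in B n) (fun t : n.-tuple T => f (sel x0 w t)).
Proof.
move=> <- wn mf.
rewrite (_ : (fun _ => _) = (fun t : (size w).-tuple T => f t) \o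
   (fun t : n.-tuple T => [tuple of map (nth x0 t) (in_tuple w)])) //.
apply: (measurable_comp _ _ mf).
- exact: measurable_tuples_in.
- move=> _ [t Bt <-]; apply/cfg_in_tuple; apply: cfg_in_sel; last exact/cfg_in_tuple.
  by rewrite size_tuple.
- apply: measurable_funTS; exact: measurable_sel.
Qed.

Lemma sel_iota i j (s : seq T) : (i + j <= size s)%N ->
  sel x0 (iota i j) s = take j (drop i s).
Proof. by move=> ijs; rewrite /sel map_nth_iota//; lia. Qed.

End Selection.

Section TensorSigma.
Context {R : realType} {d m : nat}.
Variables (k : 'I_m -> nat) (f : 'I_m -> seq (pt R d) -> R).
Variable P : {set {set 'I_(ktot k)}}.
Hypothesis admP : admissible P.
Let x0 := origin R d.

Let word (i : 'I_m) :=
  [seq index (finset.pblock P (jrank j)) (enum P) | j <- enum 'I_(k i)].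

(** Identifying variables along [P] means that each factor selects its coordinates by block
    number. *)
Lemma tensor_sigmaE x :
  tensor_sigma f P x = \prod_(i < m) f i (sel x0 (word i) x).
Proof.
by apply: eq_bigr => i _; rewrite take_drop_map /sel /word -map_comp.
Qed.

Lemma size_word i : size (word i) = k i.
Proof. by rewrite size_map size_enum_ord. Qed.

Lemma word_lt i : all (fun j => j < #|P|)%N (word i).
Proof.
apply/allP => _ /mapP[j _ ->]; have /andP[/and3P[/eqP covP _ _] _] := admP.
by rewrite cardE index_mem mem_enum finset.pblock_mem// covP inE.
Qed.

Variable B : set (pt R d).

Lemma measurable_tensor_sigma : measurable B ->
  (forall i, measurable_fun (tuples_in B (k i)) (fun t : (k i).-tuple (pt R d) => f i t)) ->
  measurable_fun (tuples_in B #|P|)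
    (fun t : #|P|.-tuple (pt R d) => tensor_sigma f P t).
Proof.
move=> mB mf; rewrite (_ : (fun _ => _) = fun t : #|P|.-tuple (pt R d) =>
  \prod_(i < m) f i (sel x0 (word i) t)); last first.
  by apply/funext => t; rewrite tensor_sigmaE.
apply: measurable_prod => i _.
exact: (measurable_fun_sel mB (size_word i) (word_lt i) (mf i)).
Qed.

Lemma tensor_sigma_ge0 s :
  (forall i x, size x = k i -> cfg_in B x -> 0 <= f i x) ->
  size s = #|P| -> cfg_in B s -> 0 <= tensor_sigma f P s.
Proof.
move=> f0 szs Bs; rewrite tensor_sigmaE; apply: prodr_ge0 => i _.
apply: f0; first by rewrite size_map size_word.
by apply: cfg_in_sel => //; rewrite szs; exact: word_lt.
Qed.

End TensorSigma.

(** * The product formulas for [m] factors and for two factors *)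

Theorem theorem3 (R : realType) (d : nat)
  (B : set (pt R d)) (lam : {measure set (pt R d) -> \bar R}) (p : seq (pt R d) -> R)
  (* B bounded Borel with positive Lebesgue measure *)
  (HBmeas : measurable B)
  (HBbdd : exists M : R, forall x, B x -> forall i, `|tnth x i| <= M)
  (HBpos : (0 < leb_vol B)%E)
  (* lam: finite atomless intensity measure on B *)
  (Hlam_out : lam (~` B) = 0%E)
  (Hlam_fin : (lam B < +oo)%E)
  (Hlam_atomless : forall x, lam [set x] = 0%E)
  (* p: hereditary probability density w.r.t. P_eta, in L_2(P_eta) *)
  (Hp_sym : forall x y, cfg_in B x -> perm_eq x y -> p x = p y)
  (Hp_meas : forall n, measurable_fun (tuples_in B n) (fun t : n.-tuple (pt R d) => p t))
  (Hp_ge0 : forall x, cfg_in B x -> 0 <= p x)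
  (Hp_int1 : poisson_expect lam B (fun x => (p x)%:E) = 1%E)
  (Hp_her : forall x y, cfg_in B (x ++ y) -> 0 < p (x ++ y) -> 0 < p x)
  (Hp_L2 : (poisson_expect lam B (fun x => (p x ^+ 2)%:E) < +oo)%E) :
  (forall (m : nat) (k : 'I_m -> nat) (f : 'I_m -> seq (pt R d) -> R),
     (forall i, measurable_fun (tuples_in B (k i))
                  (fun t : (k i).-tuple (pt R d) => f i t)) ->
     (forall i x y, size x = k i -> cfg_in B x -> perm_eq x y -> f i x = f i y) ->
     (forall i x, size x = k i -> cfg_in B x -> 0 <= f i x) ->
     (forall i, (tint lam B (fun t : (k i).-tuple (pt R d) => `|f i t|%:E) < +oo)%E) ->
     (poisson_expect lam B
        (fun x => ((\prod_(i < m) ustat (k i) (f i) x) ^+ 2)%:E) < +oo)%E ->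
     dens_expect lam B p (fun x => (\prod_(i < m) ustat (k i) (f i) x)%:E) =
     (\sum_(P : {set {set 'I_(ktot k)}} | admissible P)
        tint lam B (fun t : #|P|.-tuple (pt R d) =>
          (tensor_sigma f P t)%:E *
          dens_expect lam B p (fun y => (lamstar p t y)%:E)))%E)
  /\
  (forall (k1 k2 : nat) (f1 f2 : seq (pt R d) -> R),
     measurable_fun (tuples_in B k1) (fun t : k1.-tuple (pt R d) => f1 t) ->
     measurable_fun (tuples_in B k2) (fun t : k2.-tuple (pt R d) => f2 t) ->
     (forall x y, size x = k1 -> cfg_in B x -> perm_eq x y -> f1 x = f1 y) ->
     (forall x y, size x = k2 -> cfg_in B x -> perm_eq x y -> f2 x = f2 y) ->
     (forall x, size x = k1 -> cfg_in B x -> 0 <= f1 x) ->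
     (forall x, size x = k2 -> cfg_in B x -> 0 <= f2 x) ->
     (tint lam B (fun t : k1.-tuple (pt R d) => `|f1 t|%:E) < +oo)%E ->
     (tint lam B (fun t : k2.-tuple (pt R d) => `|f2 t|%:E) < +oo)%E ->
     (poisson_expect lam B
        (fun x => ((ustat k1 f1 x * ustat k2 f2 x) ^+ 2)%:E) < +oo)%E ->
     (k2 <= k1)%N ->
     dens_expect lam B p (fun x => (ustat k1 f1 x * ustat k2 f2 x)%:E) =
     (\sum_(0 <= j < k2.+1)
        (('C(k2, j))%:R * (k1`!)%:R / ((k1 - k2 + j)`!)%:R)%:E *
        tint lam B (fun t : (k1 + j).-tuple (pt R d) =>
          (f2 (take k2 t) * f1 (take (k2 - j) t ++ drop k2 t))%:E *
          dens_expect lam B p (fun y => (lamstar p t y)%:E)))%E).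
Proof.
split.
  move=> m k f mf _ f0 _ _.
  (* The combination runs over the admissible partitions, with unit weights. *)
  rewrite (dens_expect_ustats HBmeas Hlam_out Hlam_fin Hp_sym Hp_meas Hp_ge0 Hp_her
    (r := index_enum _) (P := @admissible m k) (a := fun=> 1)
    (k := fun P => #|P|) (g := fun P => tensor_sigma f P)) => //.
  - by under eq_bigr do rewrite mul1e.
  - by move=> P admP; exact: measurable_tensor_sigma.
  - by move=> P s admP; exact: tensor_sigma_ge0.
  - by move=> s _; rewrite prod_ustat; apply: eq_bigr => P _; rewrite mul1r.
move=> k1 k2 f1 f2 mf1 mf2 sym1 sym2 f10 f20 _ _ _ k21.
(* For [j] up to [k2] the arguments of [f2] and [f1] are selections by explicit words, which gives
   measurability and membership in [B]. *)
have w2E (j : nat) (s : seq (pt R d)) : (j <= k2)%N -> size s = (k1 + j)%N ->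
    take k2 s = sel (origin R d) (iota 0 k2) s.
  by move=> jk szs; rewrite sel_iota ?drop0// szs; lia.
have w1E (j : nat) (s : seq (pt R d)) : (j <= k2)%N -> size s = (k1 + j)%N ->
    take (k2 - j) s ++ drop k2 s =
    sel (origin R d) (iota 0 (k2 - j) ++ iota k2 (k1 - k2 + j)) s.
  move=> jk szs; rewrite /sel map_cat -!/(sel _ _ _) !sel_iota ?drop0 ?szs; try lia.
  by rewrite [X in _ = _ ++ X]take_oversize// size_drop szs; lia.
have w2lt j : (j <= k2)%N -> all (fun i => i < k1 + j)%N (iota 0 k2).
  by move=> jk; apply/allP => i; rewrite mem_iota; lia.
have w1lt j : (j <= k2)%N ->
    all (fun i => i < k1 + j)%N (iota 0 (k2 - j) ++ iota k2 (k1 - k2 + j)).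
  by move=> jk; apply/allP => i; rewrite mem_cat !mem_iota; lia.
have w1sz j : (j <= k2)%N -> size (iota 0 (k2 - j) ++ iota k2 (k1 - k2 + j)) = k1.
  by move=> jk; rewrite size_cat !size_iota; lia.
(* The bound on [j] is kept as a predicate, since the truncated difference [k2 - j] is meaningful
   only for [j] up to [k2]. *)
rewrite [RHS]big_nat.
apply: (dens_expect_ustats HBmeas Hlam_out Hlam_fin Hp_sym Hp_meas Hp_ge0 Hp_her
    (r := index_iota 0 k2.+1) (P := fun j => (0 <= j < k2.+1)%N)
    (a := fun j => ('C(k2, j))%:R * (k1`!)%:R / ((k1 - k2 + j)`!)%:R)
    (k := fun j => (k1 + j)%N)
    (g := fun j t => f2 (take k2 t) * f1 (take (k2 - j) t ++ drop k2 t))).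
- by move=> j; rewrite divr_ge0 ?mulr_ge0.
- move=> j /andP[_ jk].
  rewrite (_ : (fun _ => _) = (fun t : (k1 + j).-tuple (pt R d) =>
      f2 (sel (origin R d) (iota 0 k2) t) *
      f1 (sel (origin R d) (iota 0 (k2 - j) ++ iota k2 (k1 - k2 + j)) t))).
    apply: measurable_funM.
      exact: (measurable_fun_sel HBmeas (size_iota 0 k2) (w2lt _ jk) mf2).
    exact: (measurable_fun_sel HBmeas (w1sz _ jk) (w1lt _ jk) mf1).
  by apply/funext => t; rewrite (w2E j) ?(w1E j) ?size_tuple.
- move=> j s /andP[_ jk] szs Bs; rewrite (w2E j)// (w1E j)// mulr_ge0//.
    apply: f20; first by rewrite size_map size_iota.
    by apply: cfg_in_sel => //; rewrite szs; exact: w2lt.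
  apply: f10; first by rewrite size_map w1sz.
  by apply: cfg_in_sel => //; rewrite szs; exact: w1lt.
- move=> s Bs; rewrite -big_nat; apply: ustat_mul => //.
    by move=> u v szu us; apply: sym1 => // y /us; exact: Bs.
  by move=> u v szu us; apply: sym2 => // y /us; exact: Bs.
Qed.
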